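(* Let $a_1 > a_0$ be two elements of $\mathbb{I}$. If there exists a set $K$ of functions $\mathbb{X} \to \mathbb{R}$ such that $$\Lambda^-(a_1) = \Lambda^-(a_0) + K$$ (Minkowski sum), then the function $$\rho \in \mathcal{P}(\mathbb{X}) \mapsto J(a_1,\rho) - J(a_0,\rho)$$ is convex on $\mathcal{P}(\mathbb{X})$.
   Context: $\mathbb{X}$ is a Borel space with its Borel $\sigma$-algebra, and $\mathcal{P}(\mathbb{X})$ is the set of probability measures on $\mathbb{X}$. $\mathbb{I} \subset \mathbb{R}$ is an interval (set of initial decisions $a$). $\mathbb{B}$ is a fixed set and, for each $a \in \mathbb{I}$, $\mathbb{B}(a) \subset \mathbb{B}$ is the set of second decisions available after initial decision $a$. The utility function is $U : \mathbb{I} \times \mathbb{B} \times \mathbb{X} \to \mathbb{R}$, $(a,b,x) \mapsto U(a,b,x)$. For $a \in \mathbb{I}$ and $\rho \in \mathcal{P}(\mathbb{X})$, the Epstein functional is $$J(a,\rho) := \sup_{b \in \mathbb{B}(a)} \int_{\mathbb{X}} U(a,b,x)\, d\rho(x).$$ For $a \in \mathbb{I}$, $$\Lambda^-(a) := \{ f : \mathbb{X} \to \mathbb{R} \mid \text{there exists } b \in \mathbb{B}(a) \text{ such that } f(x) \le U(a,b,x) \text{ for all } x \in \mathbb{X} \}.$$ The Minkowski sum of two subsets $\Lambda_1,\Lambda_2$ of a vector space is $\Lambda_1 + \Lambda_2 = \{ x_1 + x_2 : x_1 \in \Lambda_1,\ x_2 \in \Lambda_2 \}$. Standing assumptions: all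 functions on $\mathbb{X}$ considered (the functions $U(a,b,\cdot)$, the elements $f$ of $\Lambda^-(a)$, and the elements of $K$) are measurable and integrable with respect to every $\rho \in \mathcal{P}(\mathbb{X})$ (so $\Lambda^-(a)$ is understood as consisting of such functions only), and the supremum defining $J(a,\rho)$ is attained for all $a \in \mathbb{I}$ and $\rho\in\mathcal{P}(\mathbb{X})$ (in particular $\mathbb{B}(a) \neq \emptyset$ and $J(a,\rho)$ is finite). *)

(* Defs.v *)
From HB Require Import structures.
From mathcomp Require Import all_boot all_order all_algebra.
From mathcomp Require Import all_classical all_reals all_analysis.
Import Order.TTheory GRing.Theory Num.Theory.
Import numFieldNormedType.Exports.

Set Implicit Arguments.
Unset Strict Implicit.
Unset Printing Implicit Defensive.

Local Open Scope classical_set_scope.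
Local Open Scope ring_scope.
Local Open Scope convex_scope.

Notation borel X := (g_sigma_algebraType (@open X)).

(* Homeomorphic to a Borel subset of a complete separable metric space [Y]; the
   last condition says that the topology of [X] is the one induced by [h]. *)
Definition borel_space (R : realType) (X : topologicalType) : Prop :=
  exists (Y : completePseudoMetricType R) (h : X -> Y),
    [/\ hausdorff_space Y,
        exists2 D : set Y, countable D & dense D,
        measurable (range h : set (borel Y)),
        injective h &
        open = [set h @^-1` V | V in @open Y]].

(* The convex structure of the set of probability measures:
   [(P <| p |> Q) A = p * P A + (1 - p) * Q A] (lemma [mixtureE]). *)
Section mixture.
Context d (T : measurableType d) (R : realType).

Lemma eq_probability (P Q : probability T R) :
  P = Q :> (set T -> \bar R) -> P = Q.
Proof.
case: P => P [[a1 a2] [b] [c] [e] [f] [g] [h]].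
case: Q => Q [[a1' a2'] [b'] [c'] [e'] [f'] [g'] [h']] /= PQ.
move: a1' a2' b' c' e' f' g' h'; rewrite -PQ => a1' a2' b' c' e' f' g' h'.
f_equal.
rewrite (Prop_irrelevance a1' a1) (Prop_irrelevance a2' a2).
rewrite (Prop_irrelevance b' b) (Prop_irrelevance c' c) (Prop_irrelevance e' e).
rewrite (Prop_irrelevance f' f) (Prop_irrelevance g' g).
by rewrite (Prop_irrelevance h' h).
Qed.

Definition mixture (p : {i01 R}) (P Q : probability T R) : set T -> \bar R :=
  measure_add (mscale p%:num%:nng P) (mscale (1 - p%:num)%:i01%:num%:nng Q).

Section instance.
Variables (p : {i01 R}) (P Q : probability T R).

Lemma mixtureE A :
  mixture p P Q A = (p%:num%:E * P A + (1 - p%:num)%:E * Q A)%E.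
Proof. by rewrite /mixture measure_addE. Qed.

HB.instance Definition _ := Measure.on (mixture p P Q).

Let mixture_setT : mixture p P Q setT = 1%E.
Proof. by rewrite mixtureE !probability_setT !mule1 -EFinD subrKC. Qed.

HB.instance Definition _ :=
  @Measure_isProbability.Build _ _ R (mixture p P Q) mixture_setT.

End instance.

Let mix (p : {i01 R}) (P Q : probability T R) : probability T R :=
  mixture p P Q.

Let mix1 P Q : mix 1%:i01 P Q = P.
Proof.
apply/eq_probability/funext => A.
by rewrite /mix/= mixtureE/= subrr mul0e mul1e adde0.
Qed.

Let mixmm p P : mix p P P = P.
Proof.
apply/eq_probability/funext => A; rewrite /mix/= mixtureE.
by rewrite -ge0_muleDl ?lee_fin// -EFinD subrKC mul1e.
Qed.

Let mixC p P Q : mix p P Q = mix (1 - p%:inum)%:i01 Q P.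
Proof.
apply/eq_probability/funext => A.
by rewrite /mix/= !mixtureE/= opprB subrKC addeC.
Qed.

Let mixA : convex_quasi_associative mix.
Proof.
move=> p q r s a b c prs spq; apply/eq_probability/funext => A.
rewrite /mix/= !mixtureE/= !mixtureE.
rewrite !ge0_muleDr ?mule_ge0 ?lee_fin//.
rewrite !muleA -!EFinM addeA; congr (_ + _ + _).
- by rewrite prs mulrC.
- by rewrite (ConvexQuasiAssoc.pq_sr prs).
- by congr (_%:E * _)%E; exact: esym spq.
Qed.

HB.instance Definition _ :=
  isConvexSpace.Build R (probability T R) mix1 mixmm mixC mixA.

End mixture.

(* [convex_function] of the library only covers subsets of an lmodType. *)
Definition convex_on_space (R : realType) (T : convType R) (f : T -> R^o) :=
  forall (t : {i01 R}) (x y : T), f (x <| t |> y) <= f x <| t |> f y.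

Definition Minkowski_sum (V : nmodType) (A B : set V) : set V :=
  [set x + y | x in A & y in B].

Section Epstein.
Context d (X : measurableType d) (R : realType).

Definition admissible (f : X -> R) : Prop :=
  measurable_fun setT f /\
  forall rho : probability X R, rho.-integrable setT (EFin \o f).

Variables (B : Type) (BB : R -> set B) (U : R -> B -> X -> R).

(* A supremum in [\bar R]: no default value hides an infinite one. *)
Definition Epstein (a : R) (rho : probability X R) : \bar R :=
  ereal_sup [set (\int[rho]_x (U a b x)%:E)%E | b in BB a].

Definition Lambda_minus (a : R) : set (X -> R) :=
  [set f | admissible f /\ exists2 b, BB a b & forall x, f x <= U a b x].

End Epstein.

(* Main.v *)
(* Let [m] be a mixture of [x] and [y] and write an optimal [U a1 b] for [m] as
   [f + k] with [f] in [Lambda_minus a0] and [k] in [K].  Then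
   [J(a1, m) - J(a0, m) <= \int k dm], while [Lambda_minus a0 + k] lies in
   [Lambda_minus a1], whence [\int k drho <= J(a1, rho) - J(a0, rho)] for every
   [rho].  As [rho |-> \int k drho] is affine, combining the first bound at [m]
   with the second at [x] and [y] gives convexity. *)
Require Import Defs.
From mathcomp Require Import all_boot all_order all_algebra.
From mathcomp Require Import all_classical all_reals all_analysis.
From mathcomp Require Import measurable_realfun.
Import Order.TTheory GRing.Theory Num.Theory.
Import numFieldNormedType.Exports.

Local Open Scope classical_set_scope.
Local Open Scope ring_scope.

Set Implicit Arguments.
Unset Strict Implicit.
Unset Printing Implicit Defensive.

Local Open Scope convex_scope.

Lemma integrable_mscale {d} {T : measurableType d} {R : realType}
    (m : {measure set T -> \bar R}) (k : {nonneg R}) (D : set T)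
    (f : T -> \bar R) :
  measurable D -> m.-integrable D f -> (mscale k m).-integrable D f.
Proof.
move=> mD /integrableP[mf foo]; apply/integrableP; split => //.
rewrite ge0_integral_mscale//; last exact: measurableT_comp.
by rewrite lte_mul_pinfty// lee_fin.
Qed.

Lemma integral_mscale {d} {T : measurableType d} {R : realType}
    (m : {measure set T -> \bar R}) (k : {nonneg R}) (D : set T)
    (f : T -> \bar R) :
  measurable D -> m.-integrable D f ->
  (\int[mscale k m]_(x in D) f x = k%:num%:E * \int[m]_(x in D) f x)%E.
Proof.
move=> mD intf; have mf := measurable_int _ intf.
rewrite (integralE m) (integralE (mscale k m)).
rewrite !ge0_integral_mscale//; first last.
- exact: measurable_funepos.
- exact: measurable_funeneg.
(* The negative part of [f] has a finite integral, so the difference is never of the form oo - oo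
   and the scalar distributes over it. *)
rewrite [RHS]muleBr// fin_num_adde_defl// fin_numN.
exact: integrable_neg_fin_num.
Qed.

Section admissible.
Context {d} {X : measurableType d} {R : realType}.
Implicit Types (f g : X -> R) (rho x y : probability X R).

(** A mixture is by construction a sum of two scaled measures, and the integral is additive and
    homogeneous in the measure. *)
Lemma Rintegral_mixture f (t : {i01 R}) x y : admissible f ->
  \int[x <| t |> y]_z f z =
  t%:num * \int[x]_z f z + (1 - t%:num) * \int[y]_z f z.
Proof.
move=> [_ intf]; rewrite /Rintegral.
have ik (rho : probability X R) k :
    (mscale k rho).-integrable setT (fun z => (f z)%:E).
  by apply: integrable_mscale => //; exact: intf.
rewrite integral_measure_add//; [|exact: ik..].
rewrite !integral_mscale//; [|exact: intf..].
(* [fine] commutes with sums and products only at finite values. *)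
have [fx fy] := (integrable_fin_num measurableT (intf x),
                 integrable_fin_num measurableT (intf y)).
by rewrite fineD ?fin_numM// !fineM.
Qed.

Lemma le_Rintegral_admissible f g rho : admissible f -> admissible g ->
  (forall z, f z <= g z) -> \int[rho]_z f z <= \int[rho]_z g z.
Proof.
move=> [_ intf] [_ intg] fg.
by apply: le_Rintegral => //; [exact: intf|exact: intg].
Qed.

Lemma RintegralD_admissible f g rho : admissible f -> admissible g ->
  \int[rho]_z (f + g) z = \int[rho]_z f z + \int[rho]_z g z.
Proof.
move=> [_ intf] [_ intg].
by rewrite -RintegralD//; [exact: intf|exact: intg].
Qed.

End admissible.

Section Epstein_theory.
Context {d} {X : measurableType d} {R : realType} {B : Type}.
Variables (BB : R -> set B) (U : R -> B -> X -> R) (a : R).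
Hypothesis U_admissible : forall b, BB a b -> admissible (U a b).
Hypothesis sup_attained : forall rho : probability X R,
  exists2 b, BB a b & (\int[rho]_x (U a b x)%:E)%E = Epstein BB U a rho.

Lemma Lambda_minus_U b : BB a b -> Lambda_minus BB U a (U a b).
Proof. by move=> ab; split; [exact: U_admissible|exists b]. Qed.

Lemma fine_Epstein_attained (rho : probability X R) :
  exists2 b, BB a b & fine (Epstein BB U a rho) = \int[rho]_x U a b x.
Proof. by have [b ab <-] := sup_attained rho; exists b. Qed.

(** The supremum is attained, hence equal to the integral of an integrable function. *)
Lemma Epstein_fin_num (rho : probability X R) :
  Epstein BB U a rho \is a fin_num.
Proof.
have [b ab <-] := sup_attained rho.
exact: (integrable_fin_num measurableT ((U_admissible ab).2 rho)).
Qed.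

Lemma Rintegral_le_Epstein (rho : probability X R) f :
  Lambda_minus BB U a f -> \int[rho]_x f x <= fine (Epstein BB U a rho).
Proof.
move=> [admf [b ab fU]].
apply: (le_trans (le_Rintegral_admissible rho admf (U_admissible ab) fU)).
(* As [fine] sends both infinities to 0, it is monotone only between finite values. *)
rewrite /Rintegral fine_le ?Epstein_fin_num//.
  exact: (integrable_fin_num measurableT ((U_admissible ab).2 rho)).
by apply: ereal_sup_ubound; exists b.
Qed.

End Epstein_theory.

Theorem proposition3 (R : realType) (X : ptopologicalType)
    (X_borel : borel_space R X)
    (I : interval R) (B : Type) (BB : R -> set B)
    (U : R -> B -> borel X -> R)
    (U_admissible : forall a b, a \in I -> BB a b -> admissible (U a b))
    (sup_attained : forall a (rho : probability (borel X) R), a \in I ->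
      exists2 b, BB a b & (\int[rho]_x (U a b x)%:E)%E = Epstein BB U a rho)
    (a0 a1 : R) (a0I : a0 \in I) (a1I : a1 \in I) (a01 : a0 < a1) :
  (exists K : set (borel X -> R),
     (forall k, K k -> admissible k) /\
     Lambda_minus BB U a1 = Minkowski_sum (Lambda_minus BB U a0) K) ->
  convex_on_space (fun rho : probability (borel X) R =>
    fine (Epstein BB U a1 rho) - fine (Epstein BB U a0 rho)).
Proof.
move=> [K [K_admissible LK]] t x y.
have adm a (aI : a \in I) b := U_admissible a b aI.
have att a (aI : a \in I) rho := sup_attained a rho aI.
have [b1 ab1 Jm] := fine_Epstein_attained (att a1 a1I) (x <| t |> y).
have : Lambda_minus BB U a1 (U a1 b1).
  exact: (Lambda_minus_U (adm _ a1I)).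
(* Only the inclusion of [Lambda_minus BB U a1] in the Minkowski sum is used here; the reverse
   inclusion gives [lb]. *)
rewrite {1}LK => -[f Lf [k Kk fkE]].
have admk := K_admissible k Kk.
have lb (rho : probability (borel X) R) : \int[rho]_z k z <=
    fine (Epstein BB U a1 rho) - fine (Epstein BB U a0 rho).
  (* With [b0] optimal for [a0] at [rho], the claim bounds the integral of [U a0 b0 + k], a member
     of [Lambda_minus BB U a1]. *)
  have [b0 ab0 ->] := fine_Epstein_attained (att a0 a0I) rho.
  rewrite lerBrDl -RintegralD_admissible//; last exact: adm.
  apply: (Rintegral_le_Epstein (adm _ a1I) (att _ a1I)).
  rewrite LK; exists (U a0 b0); first exact: (Lambda_minus_U (adm _ a0I)).
  by exists k.
apply: (@le_trans _ _ (\int[x <| t |> y]_z k z)).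
  (* By the choice of [b1], the value for [a1] at the mixture is the integral of [f] plus that of
     [k]; it remains to bound the former. *)
  rewrite Jm -fkE RintegralD_admissible//; last exact: Lf.1.
  rewrite lerBlDr [leRHS]addrC lerD2r.
  exact: (Rintegral_le_Epstein (adm _ a0I) (att _ a0I)).
rewrite Rintegral_mixture// convRE.
by apply: lerD; apply: ler_wpM2l => //; rewrite subr_ge0.
Qed.
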